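(* Let $(M,g)$ be a space-time with Ricci tensor $Ric$ and scalar curvature $s$, and let $T=Ric-\tfrac12 s\,g$ be the energy-momentum tensor given by the Einstein equations. Then the Einstein equations belong to the class $\Omega_2\oplus\Omega_3$, i.e. $d\left[T-\tfrac13(\mathrm{trace}_gT)g\right]=0$, if and only if the Weyl tensor $W$ of conformal curvature of $(M,g)$ is harmonic, i.e. $d^*W=0$.
   Context: A space-time $(M,g)$ is a smooth four-dimensional manifold $M$ with a metric $g$ of Lorentz signature $(-+++)$; $\nabla$ is its Levi-Civita connection. The curvature tensor is given by $R^k_{lij}X^l=\nabla_i\nabla_jX^k-\nabla_j\nabla_iX^k$, the Ricci tensor by $R_{ij}=R^k_{ikj}$, and the scalar curvature by $s=g^{ij}R_{ij}$. The Einstein equations are $R_{ij}-\tfrac12 s\,g_{ij}=T_{ij}$. For a symmetric 2-tensor field $a$, write $\mathrm{trace}_g a=g^{ij}a_{ij}$; the condition $da=0$ means $\nabla_ka_{ij}=\nabla_ia_{kj}$. The Einstein equations belong to the class $\Omega_2\oplus\Omega_3$ if $d\left[T-\tfrac13(\mathrm{trace}_gT)g\right]=0$ everywhere on $M$. $W$ denotes the usual Weyl conformal curvature tensor of $(M,g)$ (the totally trace-free part of the curvature tensor), with components $W^k_{lij}$ indexed as for $R^k_{lij}$. Its codifferential is $(d^*W)_{lij}=-\nabla_kW^k_{lij}$, and $W$ is called harmonic if $d^*W=0$. *)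

(* Defs.v *)
From HB Require Import structures.
From mathcomp Require Import all_boot all_order all_algebra.
From mathcomp Require Import ring.
From mathcomp Require Import all_classical all_reals.
From mathcomp Require Import topology normedtype derive.
Set Implicit Arguments.
Unset Strict Implicit.
Unset Printing Implicit Defensive.
Import Order.TTheory GRing.Theory Num.Theory.
Import numFieldNormedType.Exports.
Local Open Scope classical_set_scope.
Local Open Scope ring_scope.

(* Tensor fields are handled classically, through their components in local
   coordinates: a component is a function 'rV[R]_4 -> R, only its values on
   the (open) image of a chart being meaningful. The coordinate indices
   0, ..., 3 are the elements of 'I_4. In the name of a tensor operation, the
   digits pq give the type of its argument: p upper and q lower indices.
   Upper indices come first in the list of arguments, and the index of a
   covariant derivative precedes those of the tensor. *)

Definition pderiv (R : realType) (i : 'I_4) (f : 'rV[R]_4 -> R) :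
    'rV[R]_4 -> R :=
  fun x => 'D_(delta_mx 0 i) f x.

Definition smooth_on (R : realType) (O : set 'rV[R]_4) (f : 'rV[R]_4 -> R) :=
  forall (s : seq 'I_4) (x : 'rV[R]_4), O x ->
    {for x, continuous (foldr (@pderiv R) f s)} /\
    (forall i : 'I_4, derivable (foldr (@pderiv R) f s) x (delta_mx 0 i)).

(* The inverse is a total function, irrelevant outside of the codomain. *)
Record chart (R : realType) (M : topologicalType) := Chart {
  chart_dom : set M;
  chart_cod : set 'rV[R]_4;
  chart_map :> M -> 'rV[R]_4;
  chart_inv : 'rV[R]_4 -> M;
  chart_dom_open : open chart_dom;
  chart_cod_open : open chart_cod;
  chart_mapK : forall p, chart_dom p ->
    chart_cod (chart_map p) /\ chart_inv (chart_map p) = p;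
  chart_invK : forall x, chart_cod x ->
    chart_dom (chart_inv x) /\ chart_map (chart_inv x) = x;
  chart_map_continuous : forall p, chart_dom p -> {for p, continuous chart_map};
  chart_inv_continuous : forall x, chart_cod x -> {for x, continuous chart_inv}
}.

Definition overlap (R : realType) (M : topologicalType) (c1 c2 : chart R M) :
    set 'rV[R]_4 :=
  [set x | chart_cod c1 x /\ chart_dom c2 (chart_inv c1 x)].

Definition transition (R : realType) (M : topologicalType) (c1 c2 : chart R M)
    (k : 'I_4) : 'rV[R]_4 -> R :=
  fun x => c2 (chart_inv c1 x) 0 k.

Record manifold4 (R : realType) := Manifold4 {
  point :> topologicalType;
  point_hausdorff : hausdorff_space point;
  point_second_countable : @second_countable point;
  atlas_index : Type;
  atlas : atlas_index -> chart R point;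
  atlas_cover : forall p : point, exists u, chart_dom (atlas u) p;
  atlas_smooth : forall (u v : atlas_index) (k : 'I_4),
    smooth_on (overlap (atlas u) (atlas v)) (transition (atlas u) (atlas v) k)
}.

Definition minkowski (R : realType) : 'M[R]_4 :=
  diag_mx (\row_(i < 4) if i == 0 then -1 else 1).

Definition lorentz_signature (R : realType) (A : 'M[R]_4) :=
  exists2 P : 'M[R]_4, P \in unitmx & P *m A *m P^T = minkowski R.

Record lorentz_metric (R : realType) (M : manifold4 R) := LorentzMetric {
  metric : atlas_index M -> 'rV[R]_4 -> 'M[R]_4;
  metric_smooth : forall u (i j : 'I_4),
    smooth_on (chart_cod (atlas u)) (fun x => metric u x i j);
  metric_sym : forall u x, chart_cod (atlas u) x ->
    (metric u x)^T = metric u x;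
  metric_signature : forall u x, chart_cod (atlas u) x ->
    lorentz_signature (metric u x);
  metric_transform : forall u v x, overlap (atlas u) (atlas v) x ->
    forall i j : 'I_4,
    let t := transition (atlas u) (atlas v) in
    metric u x i j =
      \sum_(k < 4) \sum_(l < 4) pderiv i (t k) x * pderiv j (t l) x
        * metric v (\row_m t m x) k l
}.

(* A connection is given by its coefficients: G k i j stands for G^k_{ij},
   with nabla_i d_j = G^k_{ij} d_k. *)
Notation connection R := ('I_4 -> 'I_4 -> 'I_4 -> 'rV[R]_4 -> R).

Definition nabla10 (R : realType) (G : connection R)
    (X : 'I_4 -> 'rV[R]_4 -> R) (i k : 'I_4) : 'rV[R]_4 -> R :=
  fun x => pderiv i (X k) x + \sum_(m < 4) G k i m x * X m x.

Definition nabla11 (R : realType) (G : connection R)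
    (B : 'I_4 -> 'I_4 -> 'rV[R]_4 -> R) (i k j : 'I_4) : 'rV[R]_4 -> R :=
  fun x => pderiv i (B k j) x + \sum_(m < 4) G k i m x * B m j x
    - \sum_(m < 4) G m i j x * B k m x.

Definition nabla02 (R : realType) (G : connection R)
    (a : 'I_4 -> 'I_4 -> 'rV[R]_4 -> R) (k i j : 'I_4) : 'rV[R]_4 -> R :=
  fun x => pderiv k (a i j) x - \sum_(m < 4) G m k i x * a m j x
    - \sum_(m < 4) G m k j x * a i m x.

Definition nabla13 (R : realType) (G : connection R)
    (A : 'I_4 -> 'I_4 -> 'I_4 -> 'I_4 -> 'rV[R]_4 -> R)
    (n k l i j : 'I_4) : 'rV[R]_4 -> R :=
  fun x => pderiv n (A k l i j) x + \sum_(m < 4) G k n m x * A m l i j x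
    - \sum_(m < 4) G m n l x * A k m i j x
    - \sum_(m < 4) G m n i x * A k l m j x
    - \sum_(m < 4) G m n j x * A k l i m x.

(* The functions below take as argument the matrix g of the components of the
   metric in a chart. *)

Definition christoffel (R : realType) (g : 'rV[R]_4 -> 'M[R]_4) :
    connection R :=
  fun k i j x => 2^-1 * \sum_(l < 4) invmx (g x) k l *
    (pderiv i (fun y => g y j l) x + pderiv j (fun y => g y i l) x
     - pderiv l (fun y => g y i j) x).

Lemma mulmx_sumK (R : realType) (A B : 'M[R]_4) (v : 'I_4 -> R) (k : 'I_4) :
  B *m A = 1%:M -> \sum_(l < 4) B k l * (\sum_(m < 4) A l m * v m) = v k.
Proof.
move=> BA; transitivity ((B *m (A *m (\col_m v m))) k 0).
  rewrite mxE; apply: eq_bigr => l _; rewrite mxE; congr (_ * _).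
  by apply: eq_bigr => m _; rewrite !mxE.
by rewrite mulmxA BA mul1mx mxE.
Qed.

(* The Christoffel symbols are those of the Levi-Civita connection: the unique
   connection which is torsion-free and satisfies nabla g = 0. *)
Lemma christoffel_levi_civita (R : realType) (O : set 'rV[R]_4)
    (g : 'rV[R]_4 -> 'M[R]_4) (G : connection R) :
  open O -> (forall x, O x -> (g x)^T = g x) ->
  (forall x, O x -> g x \in unitmx) ->
  (forall x, O x ->
     (forall k i j, G k i j x = G k j i x) /\
     (forall k i j, nabla02 G (fun i j y => g y i j) k i j x = 0)) <->
  (forall x, O x -> forall k i j, G k i j x = christoffel g k i j x).
Proof.
move=> Oo gT gU.
have gS x i j : O x -> g x i j = g x j i by move=> /gT {1}<-; rewrite mxE.
have DS x k i j : O x ->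
    pderiv k (fun y => g y i j) x = pderiv k (fun y => g y j i) x.
  move=> Ox; apply: near_eq_derive.
  by near=> y; apply: gS; near: y; exact: open_nbhs_nbhs.
have dE x k i j : O x -> nabla02 G (fun i j y => g y i j) k i j x =
    pderiv k (fun y => g y i j) x - \sum_(m < 4) g x j m * G m k i x
      - \sum_(m < 4) g x i m * G m k j x.
  move=> Ox; rewrite /nabla02; congr (_ - _ - _); apply: eq_bigr => m _.
    by rewrite mulrC gS.
  by rewrite mulrC.
have half : 2^-1 * 2 = 1 :> R by rewrite mulVf ?pnatr_eq0.
split=> H x Ox; last split.
- move=> k i j; have [Gs Gc] := H x Ox.
  have As a b l : \sum_(m < 4) g x l m * G m a b x =
      \sum_(m < 4) g x l m * G m b a x by apply: eq_bigr => m _; rewrite Gs.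
  have DA a b l : pderiv a (fun y => g y b l) x =
      \sum_(m < 4) g x l m * G m a b x + \sum_(m < 4) g x b m * G m a l x.
    by have := Gc a b l; rewrite dE// => /eqP; rewrite !subr_eq add0r addrC
       => /eqP.
  rewrite -[LHS](mulmx_sumK (fun m => G m i j x) k (mulVmx (gU x Ox))).
  rewrite /christoffel mulr_sumr; apply: eq_bigr => l _.
  rewrite mulrCA; congr (_ * _).
  rewrite !DA (As j i l) (As i l j) (As j l i).
  rewrite [X in 2^-1 * X](_ : _ = 2 * \sum_(m < 4) g x l m * G m i j x).
    by rewrite mulrA half mul1r.
  by ring.
- move=> k i j; rewrite !H// /christoffel; congr (_ * _).
  by apply: eq_bigr => l _; congr (_ * _); rewrite (DS x l i j)//; ring.
- move=> k i j; rewrite dE//.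
  have AD a b l : \sum_(m < 4) g x l m * G m a b x =
      2^-1 * (pderiv a (fun y => g y b l) x + pderiv b (fun y => g y a l) x
        - pderiv l (fun y => g y a b) x).
    rewrite -[RHS](mulmx_sumK (fun l => 2^-1 * (pderiv a (fun y => g y b l) x
      + pderiv b (fun y => g y a l) x - pderiv l (fun y => g y a b) x)) l
      (mulmxV (gU x Ox))).
    apply: eq_bigr => m _; congr (_ * _); rewrite H// /christoffel mulr_sumr.
    by apply: eq_bigr => c _; rewrite mulrCA.
  rewrite !AD (DS x j k i)// (DS x i k j)// (DS x k j i)//.
  set a := pderiv k _ x; set b := pderiv i _ x; set c := pderiv j _ x.
  rewrite [LHS](_ : _ = (1 - 2^-1 * 2) * a); last by ring.
  by rewrite half subrr mul0r.
Unshelve. all: by end_near. Qed.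

(* At X = d_l, the identity R^k_{lij} X^l = nabla_i nabla_j X^k
   - nabla_j nabla_i X^k gives the components of the curvature tensor. *)
Definition coord_field (R : realType) (l : 'I_4) : 'I_4 -> 'rV[R]_4 -> R :=
  fun k _ => (k == l)%:R.

Definition curvature (R : realType) (g : 'rV[R]_4 -> 'M[R]_4)
    (k l i j : 'I_4) : 'rV[R]_4 -> R :=
  let G := christoffel g in
  let nablaX := fun k j => nabla10 G (@coord_field R l) j k in
  fun x => nabla11 G nablaX i k j x - nabla11 G nablaX j k i x.

Definition ricci (R : realType) (g : 'rV[R]_4 -> 'M[R]_4) (i j : 'I_4) :
    'rV[R]_4 -> R :=
  fun x => \sum_(k < 4) curvature g k i k j x.

Definition trace02 (R : realType) (g : 'rV[R]_4 -> 'M[R]_4)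
    (a : 'I_4 -> 'I_4 -> 'rV[R]_4 -> R) : 'rV[R]_4 -> R :=
  fun x => \sum_(i < 4) \sum_(j < 4) invmx (g x) i j * a i j x.

Definition scalar_curvature (R : realType) (g : 'rV[R]_4 -> 'M[R]_4) :
    'rV[R]_4 -> R :=
  trace02 g (ricci g).

Definition energy_momentum (R : realType) (g : 'rV[R]_4 -> 'M[R]_4)
    (i j : 'I_4) : 'rV[R]_4 -> R :=
  fun x => ricci g i j x - 2^-1 * scalar_curvature g x * g x i j.

Definition ricci_mixed (R : realType) (g : 'rV[R]_4 -> 'M[R]_4) (k j : 'I_4) :
    'rV[R]_4 -> R :=
  fun x => \sum_(m < 4) invmx (g x) k m * ricci g m j x.

(* The totally trace-free part of the curvature tensor in dimension n = 4;
   the coefficients are 1 / (n - 2) and 1 / ((n - 1) (n - 2)). *)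
Definition weyl (R : realType) (g : 'rV[R]_4 -> 'M[R]_4)
    (k l i j : 'I_4) : 'rV[R]_4 -> R :=
  fun x => curvature g k l i j x
    - 2^-1 * ((k == i)%:R * ricci g l j x - (k == j)%:R * ricci g l i x
              + g x l j * ricci_mixed g k i x - g x l i * ricci_mixed g k j x)
    + 6^-1 * scalar_curvature g x
        * ((k == i)%:R * g x l j - (k == j)%:R * g x l i).

Lemma weyl_trace (R : realType) (g : 'rV[R]_4 -> 'M[R]_4) (l j : 'I_4) x :
  (g x)^T = g x -> g x \in unitmx -> \sum_(k < 4) weyl g k l k j x = 0.
Proof.
move=> gT gU; rewrite /weyl big_split big_split sumrN /= -!mulr_sumr.
rewrite -/(ricci g l j x) [X in _ - _ * X]sumrB [X in _ + _ * X]sumrB.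
rewrite big_split sumrB /= -!mulr_sumr.
have D (h : 'I_4 -> R) : \sum_(k < 4) (k == j)%:R * h k = h j.
  rewrite (bigD1 j)//= eqxx mul1r big1 ?addr0// => k /negPf ->.
  by rewrite mul0r.
rewrite (D (fun k => ricci g l k x)) (D (fun k => g x l k)).
rewrite (mulmx_sumK (fun m => ricci g m j x) l (mulmxV gU)).
have -> : \sum_(k < 4) ricci_mixed g k k x = scalar_curvature g x.
  rewrite /ricci_mixed exchange_big; apply: eq_bigr => m _.
  by apply: eq_bigr => k _; rewrite -{1}gT -trmx_inv mxE.
have K (c : R) : \sum_(k < 4) (k == k)%:R * c = 4%:R * c.
  by under eq_bigr do rewrite eqxx mul1r; rewrite sumr_const card_ord mulr_natl.
by rewrite !K; field.
Qed.

Definition codiff_weyl (R : realType) (g : 'rV[R]_4 -> 'M[R]_4)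
    (l i j : 'I_4) : 'rV[R]_4 -> R :=
  fun x => - \sum_(k < 4) nabla13 (christoffel g) (weyl g) k k l i j x.

(* The condition da = 0 on O. *)
Definition closed02 (R : realType) (g : 'rV[R]_4 -> 'M[R]_4)
    (O : set 'rV[R]_4) (a : 'I_4 -> 'I_4 -> 'rV[R]_4 -> R) :=
  forall x, O x -> forall k i j : 'I_4,
    nabla02 (christoffel g) a k i j x = nabla02 (christoffel g) a i k j x.

Definition einstein_class_Omega23 (R : realType) (M : manifold4 R)
    (g : lorentz_metric M) :=
  forall u : atlas_index M,
    let gu := metric g u in
    let T := energy_momentum gu in
    closed02 gu (chart_cod (atlas u))
      (fun i j x => T i j x - 3^-1 * trace02 gu T x * gu x i j).

Definition weyl_harmonic (R : realType) (M : manifold4 R)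
    (g : lorentz_metric M) :=
  forall (u : atlas_index M) (x : 'rV[R]_4), chart_cod (atlas u) x ->
    forall l i j : 'I_4, codiff_weyl (metric g u) l i j x = 0.

(* Main.v *)
Require Import Defs.
From mathcomp Require Import all_boot all_order all_algebra.
From mathcomp Require Import all_classical all_reals.
From mathcomp Require Import topology normedtype derive.
From mathcomp Require Import ring lra.

(* With respect to a chart, let S = Ric - (s/6) g. As trace T = - s, the tensor
   T - (1/3) (trace T) g is S. The second Bianchi identity and its contraction
   div Ric = ds / 2 give
     (div W)_{lij} = 1/2 (nabla_i S_{lj} - nabla_j S_{li}),
   and S is symmetric, so that d S = 0 if and only if div W = 0. All tensors
   with an upper first index are treated as fields of 4x4 matrices: Gamma_i is
   the matrix of the Christoffel symbols G^k_{il}, in row k and column l, and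
     R_ij = d_i Gamma_j - d_j Gamma_i + [Gamma_i, Gamma_j],
     d_i g = Gamma_i^T g + g Gamma_i,
   which reduces the Bianchi identities to noncommutative algebra. *)

Set Implicit Arguments.
Unset Strict Implicit.
Unset Printing Implicit Defensive.
Import Order.TTheory GRing.Theory Num.Theory.
Import numFieldNormedType.Exports.
Local Open Scope classical_set_scope.
Local Open Scope ring_scope.

(** * Calculus of smooth functions on an open set *)

Section SmoothFunctions.
Variables (R : realType) (O : set 'rV[R]_4).
Hypothesis Oo : open O.
Implicit Types (f g : 'rV[R]_4 -> R) (x : 'rV[R]_4) (i : 'I_4) (n : nat).

Lemma near_open (P : 'rV[R]_4 -> Prop) x :
  O x -> (forall y, O y -> P y) -> \forall y \near x, P y.
Proof.
move=> Ox OP; near=> y; apply: OP; near: y; exact: open_nbhs_nbhs.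
Unshelve. all: by end_near. Qed.

(** A derivative at [x] depends only on the values near [x], and [O] is open. This lets identities
    valid only on [O] be differentiated. *)
Lemma pderiv_on f g i x :
  O x -> (forall y, O y -> f y = g y) -> pderiv i f x = pderiv i g x.
Proof. by move=> Ox fg; apply: near_eq_derive; exact: near_open. Qed.

Definition C0d f := forall x, O x ->
  {for x, continuous f} /\ forall i, derivable f x (delta_mx 0 i).

(** The recursion takes one derivative first and then asks for the regularity of the result, which
    suits inductions by the sum, product and quotient rules. Level [n] is slightly stronger than
    class C^n: the derivatives of order [n] must again have partial derivatives. *)
Fixpoint Ck n f : Prop :=
  C0d f /\ if n is m.+1 then forall i, Ck m (pderiv i f) else True.

Lemma CkSP n f : Ck n.+1 f <-> C0d f /\ forall i, Ck n (pderiv i f).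
Proof. by []. Qed.

Lemma Ck_C0d n f : Ck n f -> C0d f.
Proof. by case: n => [|n] []. Qed.

Lemma CkW n f : Ck n.+1 f -> Ck n f.
Proof.
elim: n f => [|n IH] f /CkSP[f0 fS] //.
by apply/CkSP; split=> // i; apply: IH.
Qed.

(** In [foldr] the last index of the list is differentiated first, so lists are taken apart from the
    right. *)
Lemma smooth_onP f : smooth_on O f <-> forall n, Ck n f.
Proof.
split=> [sf n|sf s].
  elim: n f sf => [|n IH] f sf; first by split=> // x; exact: (sf [::]).
  apply/CkSP; split=> [x|i]; first exact: (sf [::]).
  by apply: IH => s x Ox; have := sf (rcons s i) x Ox; rewrite foldr_rcons.
elim/last_ind: s f sf => [|s i IH] f sf x Ox.
  by have [/(_ x Ox)] := sf 0%N.
by rewrite foldr_rcons; apply: IH => // n; have /CkSP[] := sf n.+1.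
Qed.

Lemma eq_C0d f g : (forall x, O x -> f x = g x) -> C0d f -> C0d g.
Proof.
move=> fg f0 x Ox; have [fc fd] := f0 x Ox; split=> [|i].
  suff : g y @[y --> x] --> f x by rewrite fg.
  apply: cvg_trans fc; apply: (near_eq_cvg (F := nbhs x)).
  exact: (near_open Ox fg).
by apply: near_eq_derivable (fd i); exact: (near_open Ox fg).
Qed.

Lemma eq_Ck n f g : (forall x, O x -> f x = g x) -> Ck n f -> Ck n g.
Proof.
elim: n f g => [|n IH] f g fg [f0 fS]; (split; first exact: eq_C0d f0) => // i.
by apply: IH (fS i) => x Ox; exact: pderiv_on.
Qed.

Lemma C0d_cst (c : R) : C0d (fun=> c).
Proof. by move=> x Ox; split=> [|i]; [exact: cst_continuous|]. Qed.

Lemma pderiv_cst (c : R) i x : pderiv i (fun=> c) x = 0.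
Proof. exact: derive_cst. Qed.

Lemma Ck_cst n (c : R) : Ck n (fun=> c).
Proof.
elim: n c => [|n IH] c; first by split=> //; exact: C0d_cst.
apply/CkSP; split=> [|i]; first exact: C0d_cst.
by apply: eq_Ck (IH 0) => x _; rewrite pderiv_cst.
Qed.

Lemma pderivD f g i x : C0d f -> C0d g -> O x ->
  pderiv i (fun y => f y + g y) x = pderiv i f x + pderiv i g x.
Proof.
by move=> f0 g0 Ox; apply: deriveD; [apply (f0 x Ox)|apply (g0 x Ox)].
Qed.

Lemma C0dD f g : C0d f -> C0d g -> C0d (fun x => f x + g x).
Proof.
move=> f0 g0 x Ox; have [fc fd] := f0 x Ox; have [gc gd] := g0 x Ox.
by split=> [|i]; [exact: (cvgD fc gc)|exact: (derivableD (fd i) (gd i))].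
Qed.

Lemma CkD n f g : Ck n f -> Ck n g -> Ck n (fun x => f x + g x).
Proof.
elim: n f g => [|n IH] f g [f0 fS] [g0 gS]; (split; first exact: C0dD) => // i.
by apply: eq_Ck (IH _ _ (fS i) (gS i)) => x Ox; rewrite pderivD.
Qed.

Lemma pderivM f g i x : C0d f -> C0d g -> O x ->
  pderiv i (fun y => f y * g y) x = f x * pderiv i g x + pderiv i f x * g x.
Proof.
move=> f0 g0 Ox; rewrite [RHS]addrC [_ * g x]mulrC addrC.
by apply: deriveM; [apply (f0 x Ox)|apply (g0 x Ox)].
Qed.

Lemma C0dM f g : C0d f -> C0d g -> C0d (fun x => f x * g x).
Proof.
move=> f0 g0 x Ox; have [fc fd] := f0 x Ox; have [gc gd] := g0 x Ox.
by split=> [|i]; [exact: (cvgM fc gc)|exact: (derivableM (fd i) (gd i))].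
Qed.

Lemma CkM n f g : Ck n f -> Ck n g -> Ck n (fun x => f x * g x).
Proof.
elim: n f g => [|n IH] f g [f0 fS] [g0 gS]; (split; first exact: C0dM) => // i.
(* The product rule leaves one factor undifferentiated; its level is lowered from [n.+1] to [n] to
   fit the induction hypothesis. *)
have fn : Ck n f by apply: CkW.
have gn : Ck n g by apply: CkW.
by apply: eq_Ck (CkD (IH _ _ fn (gS i)) (IH _ _ (fS i) gn)) => x Ox;
  rewrite pderivM.
Qed.

Lemma C0dV f : C0d f -> (forall x, O x -> f x != 0) -> C0d (fun x => (f x)^-1).
Proof.
move=> f0 fN0 x Ox; have [fc fd] := f0 x Ox.
by split=> [|i]; [apply: continuousV|apply: derivableV]; rewrite ?fN0.
Qed.

Lemma CkV n f : Ck n f -> (forall x, O x -> f x != 0) ->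
  Ck n (fun x => (f x)^-1).
Proof.
move=> + fN0; elim: n => [|n IH] fn; have [f0 fS] := fn.
  by split=> //; exact: C0dV.
have IHn := IH (CkW fn).
split=> [|i]; first exact: C0dV.
(* The derivative of the inverse is the product of -1, two copies of the inverse, known at level [n]
   by induction, and the derivative of [f]. *)
apply: eq_Ck (CkM (CkM (Ck_cst n (-1)) (CkM IHn IHn)) (fS i)) => x Ox.
rewrite [RHS]deriveV ?fN0//; last by apply (f0 x Ox).
by rewrite -exprVn expr2 mulN1r.
Qed.

Lemma smooth_on_C0d f : smooth_on O f -> C0d f.
Proof. by move=> /smooth_onP /(_ 0%N) /Ck_C0d. Qed.

Lemma eq_smooth_on f g : (forall x, O x -> f x = g x) ->
  smooth_on O f -> smooth_on O g.
Proof.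
by move=> fg /smooth_onP sf; apply/smooth_onP => n; exact: eq_Ck (sf n).
Qed.

Lemma smooth_on_pderiv f i : smooth_on O f -> smooth_on O (pderiv i f).
Proof.
by move=> /smooth_onP sf; apply/smooth_onP => n; have /CkSP[] := sf n.+1.
Qed.

Lemma smooth_on_cst (c : R) : smooth_on O (fun=> c).
Proof. by apply/smooth_onP => n; exact: Ck_cst. Qed.

Lemma smooth_onD f g : smooth_on O f -> smooth_on O g ->
  smooth_on O (fun x => f x + g x).
Proof.
by move=> /smooth_onP sf /smooth_onP sg; apply/smooth_onP => n; exact: CkD.
Qed.

Lemma smooth_onM f g : smooth_on O f -> smooth_on O g ->
  smooth_on O (fun x => f x * g x).
Proof.
by move=> /smooth_onP sf /smooth_onP sg; apply/smooth_onP => n; exact: CkM.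
Qed.

Lemma smooth_onV f : smooth_on O f -> (forall x, O x -> f x != 0) ->
  smooth_on O (fun x => (f x)^-1).
Proof. by move=> /smooth_onP sf fN0; apply/smooth_onP => n; exact: CkV. Qed.

Lemma smooth_onN f : smooth_on O f -> smooth_on O (fun x => - f x).
Proof.
move=> /(smooth_onM (smooth_on_cst (-1))); apply: eq_smooth_on => x _.
by rewrite mulN1r.
Qed.

Lemma smooth_onB f g : smooth_on O f -> smooth_on O g ->
  smooth_on O (fun x => f x - g x).
Proof. by move=> sf /smooth_onN; exact: smooth_onD. Qed.

Lemma smooth_on_sum (I : Type) (r : seq I) (P : pred I)
    (F : I -> 'rV[R]_4 -> R) :
  (forall j, smooth_on O (F j)) ->
  smooth_on O (fun x => \sum_(j <- r | P j) F j x).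
Proof.
move=> sF; elim: r => [|j r IH].
  by under eq_fun do rewrite big_nil; exact: smooth_on_cst.
under eq_fun do rewrite big_cons; case: (P j) => //.
exact: smooth_onD.
Qed.

Lemma smooth_on_prod (I : Type) (r : seq I) (P : pred I)
    (F : I -> 'rV[R]_4 -> R) :
  (forall j, smooth_on O (F j)) ->
  smooth_on O (fun x => \prod_(j <- r | P j) F j x).
Proof.
move=> sF; elim: r => [|j r IH].
  by under eq_fun do rewrite big_nil; exact: smooth_on_cst.
under eq_fun do rewrite big_cons; case: (P j) => //.
exact: smooth_onM.
Qed.

Lemma smooth_on_det n (A : 'rV[R]_4 -> 'M[R]_n) :
  (forall a b, smooth_on O (fun x => A x a b)) ->
  smooth_on O (fun x => \det (A x)).
Proof.
move=> sA; apply: smooth_on_sum => s; apply: smooth_onM.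
  exact: smooth_on_cst.
exact: smooth_on_prod.
Qed.

(** By Cramer's rule, an entry of the inverse is a cofactor divided by the determinant, and both are
    polynomials in the entries of the matrix. *)
Lemma smooth_on_invmx n (A : 'rV[R]_4 -> 'M[R]_n) :
  (forall a b, smooth_on O (fun x => A x a b)) ->
  (forall x, O x -> A x \in unitmx) ->
  forall a b, smooth_on O (fun x => invmx (A x) a b).
Proof.
move=> sA uA a b.
have invE x : O x -> (\det (A x))^-1 * cofactor (A x) b a = invmx (A x) a b.
  by move=> /uA uAx; rewrite /invmx uAx !mxE.
apply: (eq_smooth_on invE).
apply: smooth_onM.
  apply: smooth_onV => [|x /uA]; first exact: smooth_on_det.
  by rewrite unitmxE unitfE.
apply: smooth_onM; first exact: smooth_on_cst.
apply: smooth_on_det => c d.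
by apply: eq_smooth_on (sA (lift b c) (lift a d)) => x _; rewrite !mxE.
Qed.

Lemma pderiv_sum m (F : 'I_m -> 'rV[R]_4 -> R) i x :
  (forall j, smooth_on O (F j)) -> O x ->
  pderiv i (fun y => \sum_(j < m) F j y) x = \sum_(j < m) pderiv i (F j) x.
Proof.
move=> sF Ox; rewrite /pderiv -derive_sum; last first.
  by move=> j; have [] := smooth_on_C0d (sF j) Ox.
by congr ('D__ _ x); apply/funext => y; rewrite fct_sumE.
Qed.

End SmoothFunctions.

(** * Symmetry of the second partial derivatives *)

Section Schwarz.
Variables (R : realType).
Implicit Types (f : 'rV[R]_4 -> R) (x : 'rV[R]_4) (i j : 'I_4).
Local Notation e i := (delta_mx 0 i : 'rV[R]_4).

(** The restriction of [f] to the line has the same difference quotients as [f] itself, which gives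
    access to the one-variable mean value theorem. *)
Lemma is_derive_line f x i (t : R) : derivable f (x + t *: e i) (e i) ->
  is_derive t 1 (fun s => f (x + s *: e i)) (pderiv i f (x + t *: e i)).
Proof.
move=> df.
have E : (fun h : R =>
      h^-1 *: (((fun s => f (x + s *: e i)) \o shift t) (h *: 1)
      - f (x + t *: e i))) =
    (fun h : R => h^-1 *: ((f \o shift (x + t *: e i)) (h *: e i)
      - f (x + t *: e i))).
  apply/funext => h; congr (_ *: (f _ - _)) => /=.
  by rewrite [h *: 1]mulr1 scalerDl addrCA.
by split; rewrite /derivable /derive E.
Qed.

Lemma MVT_line f x i (h : R) : 0 < h ->
  (forall t, t \in `[0, h] -> derivable f (x + t *: e i) (e i)) ->
  exists2 t, t \in `[0, h] &
    f (x + h *: e i) - f x = pderiv i f (x + t *: e i) * h.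
Proof.
move=> h0 df.
pose F s := f (x + s *: e i); pose dF s := pderiv i f (x + s *: e i).
have D t : t \in `[0, h] -> is_derive t 1 F (dF t).
  by move=> /df; exact: is_derive_line.
have Do t : t \in `]0, h[ -> is_derive t 1 F (dF t).
  by move=> th; apply: D; exact: subset_itv_oo_cc th.
have Fc : {within `[0, h], continuous F}.
  by apply: derivable_within_continuous => t /D [].
have [t th] := @MVT_segment R F dF 0 h (ltW h0) Do Fc.
by rewrite /F /dF scale0r addr0 subr0; exists t.
Qed.

(** The mean value theorem is used twice: along [e i] for the increment [F] of [f] in the direction
    [e j], then along [e j] for [pderiv i f]. The bound on [h + h] keeps the closed square of side
    [h] inside the ball. *)
Lemma mixed_difference f x i j (O : set 'rV[R]_4) (r h : R) : 0 < h ->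
  h + h < r -> (forall y, ball x r y -> O y) -> C0d O f -> C0d O (pderiv i f) ->
  exists2 y, ball x r y &
    f (x + h *: e i + h *: e j) - f (x + h *: e j) - (f (x + h *: e i) - f x)
      = pderiv j (pderiv i f) y * h * h.
Proof.
move=> h0 hr BO f0 df0.
(* The norm is the largest absolute value of an entry, so a basis vector has norm at most 1. *)
have nrm k (t : R) : t \in `[0, h] -> `|t *: e k| <= h.
  rewrite in_itv /= => /andP[t0 th]; rewrite normrZ ger0_norm//.
  rewrite (le_trans _ th)// ler_piMr// [`|_|]mx_normrE.
  apply/bigmax_leP; split=> //= -[a b] _.
  by rewrite mxE; case: (_ && _); rewrite ?normr1 ?normr0.
have inB (s t : R) : s \in `[0, h] -> t \in `[0, h] ->
    ball x r (x + s *: e i + t *: e j).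
  move=> sh th; rewrite -ball_normE /ball_ /= opprD addrA opprD addrA subrr.
  rewrite sub0r -opprD normrN (le_lt_trans (ler_normD _ _))//.
  by rewrite (le_lt_trans _ hr)// lerD// nrm.
have h0h : 0 \in `[0, h] by rewrite in_itv /= lexx ltW.
have hh : h \in `[0, h] by rewrite in_itv /= lexx ltW.
pose F y := f (y + h *: e j) - f y.
have FD s : s \in `[0, h] -> is_derive (x + s *: e i) (e i) F
   (pderiv i f (x + s *: e i + h *: e j) - pderiv i f (x + s *: e i)).
  move=> sh; have [_ d1] := f0 _ (BO _ (inB _ _ sh hh)).
  have [_ d2] := f0 _ (BO _ (inB _ _ sh h0h)); rewrite scale0r addr0 in d2.
  apply: is_deriveB; last exact: derivableP.
  have E : (fun t : R => t^-1 *: (((fun y => f (y + h *: e j)) \o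
        shift (x + s *: e i)) (t *: e i) - f (x + s *: e i + h *: e j))) =
      (fun t : R => t^-1 *: ((f \o shift (x + s *: e i + h *: e j)) (t *: e i)
        - f (x + s *: e i + h *: e j))).
    by apply/funext => t; congr (_ *: (f _ - _)) => /=; rewrite !addrA.
  split; [rewrite /derivable E; exact: d1|by rewrite /derive E].
have [s sh Es] := MVT_line h0 (f := F) (x := x)
  (fun s sh => @ex_derive _ _ _ _ _ _ _ (FD s sh)).
have [|t th Et] := MVT_line h0 (f := pderiv i f) (x := x + s *: e i) (i := j).
  by move=> t th; have [] := df0 _ (BO _ (inB _ _ sh th)).
exists (x + s *: e i + t *: e j); first exact: inB.
rewrite -Et -/(F x) -/(F (x + h *: e i)).
have -> : f (x + h *: e i + h *: e j) - f (x + h *: e j)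
    - (f (x + h *: e i) - f x) = F (x + h *: e i) - F x by rewrite /F; ring.
by rewrite Es; congr (_ * _); rewrite /pderiv; have [_] := FD s sh.
Qed.

(* The second difference of f over a small square is symmetric in i and j, and
   it is a value of either mixed derivative times the area. *)
Lemma pderivC f x i j (O : set 'rV[R]_4) : open O -> smooth_on O f -> O x ->
  pderiv i (pderiv j f) x = pderiv j (pderiv i f) x.
Proof.
move=> Oo sf Ox; apply/eqP; rewrite -subr_eq0 -normr_le0.
apply/ler_addgt0Pl => eps eps0.
rewrite addr0.
have e2 : 0 < eps / 2 by rewrite divr_gt0.
have c a b : \forall y \near x,
    `|pderiv a (pderiv b f) x - pderiv a (pderiv b f) y| < eps / 2.
  have [cab _] := sf [:: a; b] x Ox.
  by apply: (@cvgr_dist_lt _ _ _ (nbhs x) _ _ _ cab).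
have nO : nbhs x O by exact: open_nbhs_nbhs.
have /nbhs_ballP[r /= r0 rB] : nbhs x [set y | O y /\
    (`|pderiv i (pderiv j f) x - pderiv i (pderiv j f) y| < eps / 2 /\
    `|pderiv j (pderiv i f) x - pderiv j (pderiv i f) y| < eps / 2)].
  by apply: filterI nO _; apply: filterI (c i j) (c j i).
have [h h0 hr] : exists2 h : R, 0 < h & h + h < r.
  by exists (r / 3); [rewrite divr_gt0|lra].
have BO y : ball x r y -> O y by move=> /rB [].
have C1 := smooth_on_C0d sf.
have C2 k := smooth_on_C0d (smooth_on_pderiv k sf).
have [y /rB[_ [_ yB]] Ey] := mixed_difference j h0 hr BO C1 (C2 i).
have [z /rB[_ [zB _]] Ez] := mixed_difference i h0 hr BO C1 (C2 j).
(* The two second differences differ only by the order of the middle terms; the area [h * h] is then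
   cancelled. *)
have yz : pderiv j (pderiv i f) y = pderiv i (pderiv j f) z.
  apply: (mulIf (lt0r_neq0 h0)); apply: (mulIf (lt0r_neq0 h0)).
  have sw (p q u v : R) : p - q - (u - v) = p - u - (q - v) by ring.
  apply: etrans (esym Ey) _.
  apply: etrans _ Ez.
  rewrite [x + _ + _]addrAC.
  exact: sw.
rewrite yz distrC in yB.
apply: le_trans (ler_distD (pderiv i (pderiv j f) z) _ _) _.
by apply: le_trans (lerD (ltW zB) (ltW yB)) _; rewrite -splitr.
Qed.

End Schwarz.

(** * Matrix fields and their partial derivatives *)

Lemma addmxE (V : nmodType) m n (A B : 'M[V]_(m, n)) i j :
  (A + B) i j = A i j + B i j.
Proof. by rewrite mxE. Qed.

Lemma oppmxE (V : zmodType) m n (A : 'M[V]_(m, n)) i j : (- A) i j = - A i j.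
Proof. by rewrite mxE. Qed.

Lemma scalemxE (V : pzRingType) m n (c : V) (A : 'M[V]_(m, n)) i j :
  (c *: A) i j = c * A i j.
Proof. by rewrite mxE. Qed.

Section MatrixFields.
Variables (R : realType) (O : set 'rV[R]_4).
Hypothesis Oo : open O.
Implicit Types (A B : 'rV[R]_4 -> 'M[R]_4) (x : 'rV[R]_4).

Definition smooth_mx A := forall k l, smooth_on O (fun x => A x k l).

(* Locked: comparing two partial derivatives up to conversion would unfold the
   limits which define them. *)
Definition pderivmx : 'I_4 -> ('rV[R]_4 -> 'M[R]_4) -> 'rV[R]_4 -> 'M[R]_4 :=
  locked (fun i A x => \matrix_(k, l) pderiv i (fun y => A y k l) x).

Lemma pderivmxE i A x k l : pderivmx i A x k l = pderiv i (fun y => A y k l) x.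
Proof. by rewrite /pderivmx -lock mxE. Qed.

Lemma smooth_mxD A B : smooth_mx A -> smooth_mx B ->
  smooth_mx (fun x => A x + B x).
Proof.
move=> sA sB k l.
apply: (eq_smooth_on Oo) (smooth_onD Oo (sA k l) (sB k l)) => x _.
by rewrite mxE.
Qed.

Lemma smooth_mxN A : smooth_mx A -> smooth_mx (fun x => - A x).
Proof.
move=> sA k l.
by apply: (eq_smooth_on Oo) (smooth_onN Oo (sA k l)) => x _; rewrite mxE.
Qed.

Lemma smooth_mxM A B : smooth_mx A -> smooth_mx B ->
  smooth_mx (fun x => A x *m B x).
Proof.
move=> sA sB k l.
apply: (eq_smooth_on Oo (f := fun x => \sum_j A x k j * B x j l)).
  by move=> x _; rewrite mxE.
by apply: smooth_on_sum => // j; exact: smooth_onM.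
Qed.

Lemma smooth_mx_tr A : smooth_mx A -> smooth_mx (fun x => (A x)^T).
Proof.
by move=> sA k l; apply: (eq_smooth_on Oo) (sA l k) => x _; rewrite mxE.
Qed.

Lemma smooth_pderivmx i A : smooth_mx A -> smooth_mx (pderivmx i A).
Proof.
move=> sA k l.
apply: (eq_smooth_on Oo) (smooth_on_pderiv i (sA k l)) => x _.
by rewrite pderivmxE.
Qed.

Lemma pderivmx_on i A B x : O x -> (forall y, O y -> A y = B y) ->
  pderivmx i A x = pderivmx i B x.
Proof.
move=> Ox AB; apply/matrixP => k l; rewrite !pderivmxE.
by apply: (pderiv_on Oo) => // y Oy; rewrite AB.
Qed.

Lemma pderivmx_cst i (A : 'M[R]_4) x : pderivmx i (fun=> A) x = 0.
Proof. by apply/matrixP => k l; rewrite pderivmxE pderiv_cst mxE. Qed.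

Lemma pderivmx_tr i A x : pderivmx i (fun y => (A y)^T) x = (pderivmx i A x)^T.
Proof.
apply/matrixP => k l; rewrite [RHS]mxE !pderivmxE; congr (pderiv i _ x).
by apply/funext => y; rewrite mxE.
Qed.

Lemma pderivmxD i A B x : smooth_mx A -> smooth_mx B -> O x ->
  pderivmx i (fun y => A y + B y) x = pderivmx i A x + pderivmx i B x.
Proof.
move=> sA sB Ox; apply/matrixP => k l; rewrite [RHS]mxE !pderivmxE.
under [fun y => (A y + B y) k l]eq_fun do rewrite mxE.
by apply: pderivD Ox; apply: smooth_on_C0d.
Qed.

(** The sum of [- A] and [A] is constant, so their derivatives add up to 0. *)
Lemma pderivmxN i A x : smooth_mx A -> O x ->
  pderivmx i (fun y => - A y) x = - pderivmx i A x.
Proof.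
move=> sA Ox; apply/eqP; rewrite -addr_eq0 -(pderivmxD i (smooth_mxN sA) sA Ox).
by under [fun y => _ + _]eq_fun do rewrite addNr; rewrite pderivmx_cst.
Qed.

Lemma pderivmxM i A B x : smooth_mx A -> smooth_mx B -> O x ->
  pderivmx i (fun y => A y *m B y) x =
    pderivmx i A x *m B x + A x *m pderivmx i B x.
Proof.
move=> sA sB Ox; apply/matrixP => k l; rewrite [RHS]mxE !mxE pderivmxE.
under [fun y => (A y *m B y) k l]eq_fun do rewrite mxE.
have sAB j : smooth_on O (fun y => A y k j * B y j l) by exact: smooth_onM.
rewrite (pderiv_sum i sAB Ox).
rewrite -big_split; apply: eq_bigr => j _ /=.
rewrite (pderivM i (smooth_on_C0d (sA k j)) (smooth_on_C0d (sB j l)) Ox).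
by rewrite !pderivmxE addrC.
Qed.

Lemma pderivmxC i j A x : smooth_mx A -> O x ->
  pderivmx i (pderivmx j A) x = pderivmx j (pderivmx i A) x.
Proof.
move=> sA Ox; apply/matrixP => k l; rewrite !pderivmxE.
have E a : (fun y => pderivmx a A y k l) = pderiv a (fun y => A y k l).
  by apply/funext => y; rewrite pderivmxE.
by rewrite !E; exact: pderivC Oo (sA k l) Ox.
Qed.

End MatrixFields.

(** * The Levi-Civita connection and its curvature in matrix form *)

Section LeviCivita.
Variables (R : realType) (O : set 'rV[R]_4) (g : 'rV[R]_4 -> 'M[R]_4).
Hypotheses (Oo : open O) (sg : smooth_mx O g).
Hypotheses (gT : forall x, O x -> (g x)^T = g x).
Hypotheses (gU : forall x, O x -> g x \in unitmx).
Implicit Types (A B : 'rV[R]_4 -> 'M[R]_4) (x : 'rV[R]_4) (i j k l n : 'I_4).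

Local Notation G := (christoffel g).

Definition connmx : 'I_4 -> 'rV[R]_4 -> 'M[R]_4 :=
  locked (fun i x => \matrix_(k, l) G k i l x).

Definition curvmx : 'I_4 -> 'I_4 -> 'rV[R]_4 -> 'M[R]_4 :=
  locked (fun i j x => \matrix_(k, l) curvature g k l i j x).

Definition ricmx : 'rV[R]_4 -> 'M[R]_4 :=
  locked (fun x => \matrix_(i, j) ricci g i j x).

Lemma connmxE i x k l : connmx i x k l = G k i l x.
Proof. by rewrite /connmx -lock mxE. Qed.

Lemma curvmx_curvature i j x k l : curvmx i j x k l = curvature g k l i j x.
Proof. by rewrite /curvmx -lock mxE. Qed.

Lemma ricmxE x i j : ricmx x i j = ricci g i j x.
Proof. by rewrite /ricmx -lock mxE. Qed.

Lemma smooth_invg : smooth_mx O (fun x => invmx (g x)).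
Proof. by move=> k l; apply: smooth_on_invmx. Qed.

Lemma smooth_christoffel k i j : smooth_on O (G k i j).
Proof.
apply: smooth_onM => //; first exact: smooth_on_cst.
apply: smooth_on_sum => // l; apply: smooth_onM => //; first exact: smooth_invg.
apply: smooth_onB => //; last exact: smooth_on_pderiv.
by apply: smooth_onD => //; exact: smooth_on_pderiv.
Qed.

Lemma smooth_connmx i : smooth_mx O (connmx i).
Proof.
move=> k l; apply: (eq_smooth_on Oo) (smooth_christoffel k i l) => x _.
by rewrite connmxE.
Qed.

(** The characterisation of the Levi-Civita connection is applied to the Christoffel symbols
    themselves, for which the required equality of coefficients is trivial. *)
Lemma christoffelC k i j x : O x -> G k i j x = G k j i x.
Proof.
have [_ /(_ (fun _ _ _ _ _ => erefl)) LC] :=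
  christoffel_levi_civita (christoffel g) Oo gT gU.
by move=> /LC[].
Qed.

Lemma nabla02E n A i j x : nabla02 G (fun i j y => A y i j) n i j x =
  (pderivmx n A x - (connmx n x)^T *m A x - A x *m connmx n x) i j.
Proof.
rewrite /nabla02 !(addmxE, oppmxE) pderivmxE; congr (_ - _ - _).
  by rewrite mxE; apply: eq_bigr => m _; rewrite mxE connmxE.
by rewrite mxE; apply: eq_bigr => m _; rewrite connmxE mulrC.
Qed.

Lemma nabla11E n A k j x : nabla11 G (fun k j y => A y k j) n k j x =
  (pderivmx n A x + connmx n x *m A x - A x *m connmx n x) k j.
Proof.
rewrite /nabla11 !(addmxE, oppmxE) pderivmxE; congr (_ + _ - _).
  by rewrite mxE; apply: eq_bigr => m _; rewrite connmxE.
by rewrite mxE; apply: eq_bigr => m _; rewrite connmxE mulrC.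
Qed.

Lemma pderivmx_metric n x : O x ->
  pderivmx n g x = (connmx n x)^T *m g x + g x *m connmx n x.
Proof.
have [_ /(_ (fun _ _ _ _ _ => erefl)) LC] :=
  christoffel_levi_civita (christoffel g) Oo gT gU.
move=> /LC[_ Lg]; apply/eqP; rewrite -subr_eq0 opprD addrA; apply/eqP.
by apply/matrixP => i j; rewrite -nabla02E Lg mxE.
Qed.

(** Differentiate the product of [g] and its inverse, which is constant, and insert the derivative
    of [g] given by metric compatibility. *)
Lemma pderivmx_invg n x : O x -> pderivmx n (fun y => invmx (g y)) x =
  - (connmx n x *m invmx (g x)) - invmx (g x) *m (connmx n x)^T.
Proof.
move=> Ox; have gUx := gU Ox.
have := pderivmx_cst n (1%:M : 'M[R]_4) x.
rewrite (pderivmx_on Oo n (B := fun y => g y *m invmx (g y)) Ox); last first.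
  by move=> y Oy; rewrite mulmxV ?gU.
rewrite (pderivmxM Oo n sg smooth_invg Ox) pderivmx_metric// => /eqP.
rewrite addrC addr_eq0 => /eqP /(congr1 (mulmx (invmx (g x)))).
rewrite mulmxA mulVmx// mul1mx => ->.
rewrite mulmxN mulmxDl mulmxDr -!mulmxA mulmxV// mulmx1.
by rewrite (mulmxA (invmx (g x)) (g x)) mulVmx// mul1mx opprD addrC.
Qed.

Lemma curvmxE i j x : O x -> curvmx i j x =
  pderivmx i (connmx j) x - pderivmx j (connmx i) x
    + connmx i x *m connmx j x - connmx j x *m connmx i x.
Proof.
move=> Ox; apply/matrixP => k l.
(* The coordinate field has constant components, so only the term [m = l] of the connection sum
   survives. *)
have E : (fun a b => nabla10 G (@coord_field R l) b a) = (fun a b => G a b l).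
  apply/funext => a; apply/funext => b; apply/funext => y.
  rewrite /nabla10 pderiv_cst add0r (bigD1 l)//=.
  rewrite /coord_field eqxx mulr1 big1 ?addr0// => m /negPf ->.
  by rewrite mulr0.
have curvE : curvature g k l i j x = nabla11 G (fun a b => G a b l) i k j x
    - nabla11 G (fun a b => G a b l) j k i x by rewrite -E.
have P a b : pderiv a (G k b l) x = pderivmx a (connmx b) x k l.
  rewrite pderivmxE; congr (pderiv a _ x).
  by apply/funext => y; rewrite connmxE.
have Q a b : \sum_(m < 4) G k a m x * G m b l x =
    (connmx a x *m connmx b x) k l.
  by rewrite mxE; apply: eq_bigr => m _; rewrite !connmxE.
(* The correction terms for the lower index of nabla X are symmetric in [i] and [j], as there is no
   torsion, and drop out of the alternation. *)
have S : \sum_(m < 4) G m i j x * G k m l x =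
    \sum_(m < 4) G m j i x * G k m l x.
  by apply: eq_bigr => m _; rewrite christoffelC.
rewrite curvmx_curvature curvE /nabla11 S (P i j) (P j i) (Q i j) (Q j i).
rewrite !(addmxE, oppmxE).
move: (\sum_(m < 4) _) (pderivmx i _ _ _ _) (pderivmx j _ _ _ _).
by move: ((connmx i x *m _) _ _) ((connmx j x *m _) _ _) => p q r s t; ring.
Qed.

End LeviCivita.

(** * Symmetries of the curvature and the Bianchi identities *)

Section Bianchi.
Variables (R : realType) (O : set 'rV[R]_4) (g : 'rV[R]_4 -> 'M[R]_4).
Hypotheses (Oo : open O) (sg : smooth_mx O g).
Hypotheses (gT : forall x, O x -> (g x)^T = g x).
Hypotheses (gU : forall x, O x -> g x \in unitmx).
Implicit Types (A B : 'rV[R]_4 -> 'M[R]_4) (x : 'rV[R]_4) (i j k l n : 'I_4).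

Local Notation G := (christoffel g).
Local Notation Gam := (connmx g).
Local Notation Rm := (curvmx g).

Let sGam i : smooth_mx O (Gam i) := smooth_connmx Oo sg gU i.

Lemma smooth_curvmx i j : smooth_mx O (Rm i j).
Proof.
have sP a b := smooth_pderivmx Oo a (sGam b).
have sM a b := smooth_mxM Oo (sGam a) (sGam b).
have sA := smooth_mxD Oo (smooth_mxD Oo (smooth_mxD Oo (sP i j)
  (smooth_mxN Oo (sP j i))) (sM i j)) (smooth_mxN Oo (sM j i)).
move=> k l; apply: (eq_smooth_on Oo) (sA k l) => x Ox.
by rewrite (curvmxE Oo gT gU).
Qed.

Lemma curvmxN i j x : O x -> Rm j i x = - Rm i j x.
Proof.
move=> Ox; rewrite !(curvmxE Oo gT gU)//.
move: (pderivmx i _ x) (pderivmx j _ x) (Gam i x *m _) (Gam j x *m _).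
move=> p q r s.
by apply/matrixP => a b; rewrite !(addmxE, oppmxE); ring.
Qed.

Lemma pderivmx_curvmx n i j x : O x -> pderivmx n (Rm i j) x =
  pderivmx n (pderivmx i (Gam j)) x - pderivmx n (pderivmx j (Gam i)) x
  + (pderivmx n (Gam i) x *m Gam j x + Gam i x *m pderivmx n (Gam j) x)
  - (pderivmx n (Gam j) x *m Gam i x + Gam j x *m pderivmx n (Gam i) x).
Proof.
move=> Ox; rewrite (pderivmx_on Oo n Ox (@curvmxE _ _ _ Oo gT gU i j)).
have sP a b := smooth_pderivmx Oo a (sGam b).
have sN a b := smooth_mxN Oo (sP a b).
have sM a b := smooth_mxM Oo (sGam a) (sGam b).
have sNM a b := smooth_mxN Oo (sM a b).
have sB := smooth_mxD Oo (sP i j) (sN j i).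
have sC := smooth_mxD Oo sB (sM i j).
rewrite (pderivmxD n sC (sNM j i) Ox) (pderivmxD n sB (sM i j) Ox).
rewrite (pderivmxD n (sP i j) (sN j i) Ox).
rewrite (pderivmxN Oo n (sP j i) Ox) (pderivmxN Oo n (sM j i) Ox).
rewrite (pderivmxM Oo n (sGam i) (sGam j) Ox).
by rewrite (pderivmxM Oo n (sGam j) (sGam i) Ox).
Qed.

(** Since there is no torsion, the column index of a connection matrix may be exchanged with its
    direction, both in its derivatives and in products where it is the right factor. The cyclic sum
    then cancels in pairs. *)
Lemma first_bianchi k l i j x : O x ->
  Rm i j x k l + Rm j l x k i + Rm l i x k j = 0.
Proof.
move=> Ox; rewrite !(curvmxE Oo gT gU)// !(addmxE, oppmxE).
have P a b c : pderivmx a (Gam b) x k c = pderivmx a (Gam c) x k b.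
  rewrite !pderivmxE; apply: (pderiv_on Oo a Ox) => y Oy; rewrite !connmxE.
  exact: (christoffelC Oo gT gU).
have M a b c : (Gam a x *m Gam b x) k c = (Gam a x *m Gam c x) k b.
  rewrite mxE [RHS]mxE; apply: eq_bigr => m _; rewrite !(connmxE, mxE).
  by rewrite (christoffelC Oo gT gU m b c).
rewrite (P i j l) (P j l i) (P l i j) (M i j l) (M j l i) (M l i j).
move: (pderivmx i _ _ _ _) (pderivmx j _ _ _ _) (pderivmx l _ _ _ _).
move: ((Gam i x *m _) _ _) ((Gam j x *m _) _ _) ((Gam l x *m _) _ _).
by move=> p q r s t u; ring.
Qed.

(* Differentiate [nabla g = 0] once more: the second derivatives of the metric
   cancel by the symmetry of mixed partial derivatives. *)
Lemma curvmx_skew i j x : O x -> (Rm i j x)^T *m g x + g x *m Rm i j x = 0.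
Proof.
have sGT a := smooth_mx_tr Oo (sGam a).
have D a b y : O y -> pderivmx a (pderivmx b g) y =
    ((pderivmx a (Gam b) y)^T *m g y
      + (Gam b y)^T *m ((Gam a y)^T *m g y + g y *m Gam a y))
    + (((Gam a y)^T *m g y + g y *m Gam a y) *m Gam b y
      + g y *m pderivmx a (Gam b) y).
  move=> Oy; rewrite (pderivmx_on Oo a Oy (@pderivmx_metric _ _ _ Oo gT gU b)).
  have sgG := smooth_mxM Oo sg (sGam b).
  rewrite (pderivmxD a (smooth_mxM Oo (sGT b) sg) sgG Oy).
  rewrite (pderivmxM Oo a (sGT b) sg Oy) (pderivmxM Oo a sg (sGam b) Oy).
  by rewrite pderivmx_tr (pderivmx_metric Oo gT gU).
move=> Ox; have := pderivmxC Oo i j sg Ox.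
rewrite !D// (curvmxE Oo gT gU)// => /eqP; rewrite -subr_eq0 => /eqP <-.
move: (pderivmx i _ x) (pderivmx j _ x) (Gam i x) (Gam j x) (g x) => p q a b h.
rewrite !(raddfD, raddfN) /= !trmx_mul.
rewrite !(mulmxDl, mulmxDr, mulmxBl, mulmxBr, mulNmx, mulmxN, mulmxA).
by apply/matrixP => s t; rewrite !(addmxE, oppmxE); ring.
Qed.

(** The entry in row [k] and column [l] is nabla_n R^k_{lij}: the commutator with Gamma_n accounts
    for [k] and [l], the two sums for [i] and [j]. *)
Definition covcurv n i j x : 'M[R]_4 :=
  pderivmx n (Rm i j) x + Gam n x *m Rm i j x - Rm i j x *m Gam n x
  - \sum_m G m n i x *: Rm m j x - \sum_m G m n j x *: Rm i m x.

Lemma nabla13_curvature n k l i j x :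
  nabla13 G (curvature g) n k l i j x = covcurv n i j x k l.
Proof.
rewrite /covcurv !(addmxE, oppmxE) /nabla13 pderivmxE !summxE.
have -> : (fun y => Rm i j y k l) = curvature g k l i j.
  by apply/funext => y; rewrite curvmx_curvature.
have -> : (Gam n x *m Rm i j x) k l = \sum_m G k n m x * curvature g m l i j x.
  by rewrite mxE; apply: eq_bigr => m _; rewrite connmxE curvmx_curvature.
have -> : (Rm i j x *m Gam n x) k l = \sum_m G m n l x * curvature g k m i j x.
  by rewrite mxE; apply: eq_bigr => m _; rewrite connmxE curvmx_curvature mulrC.
by congr (_ - _ - _); apply: eq_bigr => m _; rewrite mxE curvmx_curvature.
Qed.

Lemma covcurvN n i j x : O x -> covcurv n j i x = - covcurv n i j x.
Proof.
move=> Ox; have E : forall y, O y -> Rm j i y = - Rm i j y by exact: curvmxN.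
rewrite /covcurv (pderivmx_on Oo n Ox E) E//.
rewrite (pderivmxN Oo n (smooth_curvmx i j) Ox).
have F a b : \sum_m G m n a x *: Rm b m x = - \sum_m G m n a x *: Rm m b x.
  by rewrite -sumrN; apply: eq_bigr => m _; rewrite (curvmxN m b Ox) scalerN.
rewrite !F mulmxN mulNmx.
move: (pderivmx _ _ _) (_ *m _) (_ *m _) (\sum_m _) (\sum_m _) => p q r s t.
by apply/matrixP => a b; rewrite !(addmxE, oppmxE); ring.
Qed.

Lemma second_bianchi n i j x : O x ->
  covcurv n i j x + covcurv i j n x + covcurv j n i x = 0.
Proof.
move=> Ox; rewrite /covcurv.
(* With the skewness of the curvature and the symmetry of the connection, the six sums over lower
   indices cancel in pairs. *)
have F a b c : \sum_m G m a b x *: Rm c m x = - \sum_m G m b a x *: Rm m c x.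
  rewrite -sumrN; apply: eq_bigr => m _.
  by rewrite (curvmxN m c Ox) scalerN (christoffelC Oo gT gU).
rewrite !F !pderivmx_curvmx// !(curvmxE Oo gT gU)//.
(* Once the second derivatives are identified, what remains is an identity between noncommuting
   matrices; its cubic part is the Jacobi identity. *)
rewrite (pderivmxC Oo i n (sGam j) Ox) (pderivmxC Oo j i (sGam n) Ox).
rewrite (pderivmxC Oo n j (sGam i) Ox).
move: (\sum_m G m n i x *: _) (\sum_m G m i j x *: _) (\sum_m G m j n x *: _).
move: (pderivmx n (pderivmx i _) x) (pderivmx i (pderivmx j _) x).
move: (pderivmx j (pderivmx n _) x).
move: (pderivmx n (Gam i) x) (pderivmx n (Gam j) x) (pderivmx i (Gam j) x).
move: (pderivmx i (Gam n) x) (pderivmx j (Gam n) x) (pderivmx j (Gam i) x).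
move: (Gam n x) (Gam i x) (Gam j x) => a b c p q r s t u v w z X Y Z.
rewrite !(mulmxDl, mulmxDr, mulmxBl, mulmxBr, mulNmx, mulmxN, mulmxA).
by apply/matrixP => e f; rewrite !(addmxE, oppmxE) !mxE; ring.
Qed.

(** Differentiate the skewness of the curvature; as nabla g = 0, the connection terms recombine into
    [covcurv], the sums over [i] and [j] being skew term by term. *)
Lemma covcurv_skew n i j x : O x ->
  (covcurv n i j x)^T *m g x + g x *m covcurv n i j x = 0.
Proof.
move=> Ox; have sR a b := smooth_curvmx a b.
have sRT := smooth_mx_tr Oo (sR i j).
have := pderivmx_cst n (0 : 'M[R]_4) x.
rewrite (pderivmx_on Oo n Ox (fun y Oy => esym (@curvmx_skew i j y Oy))).
rewrite (pderivmxD n (smooth_mxM Oo sRT sg) (smooth_mxM Oo sg (sR i j)) Ox).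
rewrite (pderivmxM Oo n sRT sg Ox) (pderivmxM Oo n sg (sR i j) Ox) pderivmx_tr.
rewrite (pderivmx_metric Oo gT gU)// => E.
have skew a b (c : R) : (c *: Rm a b x)^T *m g x = - (g x *m (c *: Rm a b x)).
  apply/eqP; rewrite -addr_eq0 linearZ -scalemxAl -scalemxAr -scalerDr.
  by rewrite curvmx_skew// scaler0.
have skewS (F : 'I_4 -> 'M[R]_4) :
    (forall m, (F m)^T *m g x = - (g x *m F m)) ->
    (\sum_m F m)^T *m g x = - (g x *m \sum_m F m).
  move=> H; rewrite raddf_sum mulmx_suml mulmx_sumr -sumrN.
  by apply: eq_bigr => m _; rewrite H.
have S1 := skewS _ (fun m => skew m j (G m n i x)).
have S2 := skewS _ (fun m => skew i m (G m n j x)).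
have S0 := skew i j 1; rewrite scale1r in S0.
move: E S0 S1 S2; rewrite /covcurv.
move: (\sum_m _) (\sum_m _) (Gam n x) (Rm i j x) (pderivmx _ _ _) (g x).
move=> X Y a r p h E S0 S1 S2.
have A1 : a^T *m r^T *m h = - (a^T *m h *m r).
  by rewrite -mulmxA S0 mulmxN mulmxA.
have A2 : h *m r *m a = - (r^T *m h *m a) by rewrite S0 mulNmx opprK.
rewrite -[RHS]E !(raddfD, raddfN) /= !trmx_mul.
rewrite !(mulmxDl, mulmxDr, mulmxBl, mulmxBr, mulNmx, mulmxN, mulmxA).
rewrite A1 A2 S1 S2.
by apply/matrixP => e f; rewrite !(addmxE, oppmxE); ring.
Qed.

End Bianchi.

(** * Ricci and scalar curvature, contracted Bianchi identities *)

Section RicciCurvature.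
Variables (R : realType) (O : set 'rV[R]_4) (g : 'rV[R]_4 -> 'M[R]_4).
Hypotheses (Oo : open O) (sg : smooth_mx O g).
Hypotheses (gT : forall x, O x -> (g x)^T = g x).
Hypotheses (gU : forall x, O x -> g x \in unitmx).
Implicit Types (x : 'rV[R]_4) (i j k l n : 'I_4).

Local Notation G := (christoffel g).
Local Notation Gam := (connmx g).
Local Notation Rm := (curvmx g).
Local Notation Ric := (ricmx g).
Local Notation s := (scalar_curvature g).

Lemma ricmx_curvmx x l j : Ric x l j = \sum_k Rm k j x k l.
Proof. by rewrite ricmxE; apply: eq_bigr => k _; rewrite curvmx_curvature. Qed.

Lemma smooth_ricmx : smooth_mx O Ric.
Proof.
move=> l j.
have sS : smooth_on O (fun x => \sum_k Rm k j x k l).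
  by apply: (smooth_on_sum Oo) => k; exact: (smooth_curvmx Oo sg gT gU).
by apply: (eq_smooth_on Oo) sS => x _; rewrite ricmx_curvmx.
Qed.

Lemma smooth_scalar_curvature : smooth_on O s.
Proof.
apply: (smooth_on_sum Oo) => i; apply: (smooth_on_sum Oo) => j.
apply: (smooth_onM Oo); first exact: (smooth_invg Oo sg gU).
by apply: (eq_smooth_on Oo) (smooth_ricmx i j) => x _; rewrite ricmxE.
Qed.

Lemma invmxT x : O x -> (invmx (g x))^T = invmx (g x).
Proof. by move=> Ox; rewrite trmx_inv gT. Qed.

(** Raising the second index turns skewness with respect to [g] into antisymmetry of a matrix. *)
Lemma skew_mul_invmx (A : 'M[R]_4) x : O x -> A^T *m g x + g x *m A = 0 ->
  (A *m invmx (g x))^T = - (A *m invmx (g x)).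
Proof.
move=> Ox /eqP; rewrite addr_eq0 => /eqP E; have gUx := gU Ox.
rewrite trmx_mul invmxT// -[A^T](mulmxK gUx) E mulmxA mulmxN mulNmx.
by rewrite mulKmx.
Qed.

(** By skewness the transpose is conjugate, through [g], to the opposite matrix, so the trace equals
    its opposite. *)
Lemma curvmx_tr0 i j x : O x -> \tr (Rm i j x) = 0.
Proof.
move=> Ox; have gUx := gU Ox.
have /eqP := curvmx_skew Oo sg gT gU i j Ox; rewrite addr_eq0 => /eqP E.
have : \tr (Rm i j x) = - \tr (Rm i j x).
  rewrite -{1}mxtrace_tr -[(Rm i j x)^T](mulmxK gUx) E mulNmx raddfN /=.
  by rewrite mxtrace_mulC mulKmx.
by move/eqP; rewrite -addr_eq0 -mulr2n mulrn_eq0 => /eqP.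
Qed.

(** Contract the first Bianchi identity: one term is the trace of a curvature matrix, which
    vanishes, and the other two are Ricci components up to sign. *)
Lemma ricmxT x : O x -> (Ric x)^T = Ric x.
Proof.
move=> Ox; apply/matrixP => j l; rewrite mxE !ricmx_curvmx; apply/eqP.
rewrite -subr_eq0; apply/eqP.
have -> : \sum_k Rm k l x k j = - \sum_k Rm l k x k j.
  rewrite -sumrN; apply: eq_bigr => k _.
  by rewrite (curvmxN Oo gT gU k l Ox) mxE opprK.
have T0 : \sum_k Rm j l x k k = 0 := curvmx_tr0 j l Ox.
have : \sum_k (Rm k j x k l + Rm j l x k k + Rm l k x k j) = 0.
  by apply: big1 => k _; exact: (first_bianchi Oo gT gU k l k j Ox).
by rewrite 2!big_split /= T0 addr0 opprK.
Qed.

Definition covric n x : 'M[R]_4 :=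
  pderivmx n Ric x - (Gam n x)^T *m Ric x - Ric x *m Gam n x.

(** Covariant differentiation commutes with contraction because the connection terms of the
    contracted upper and lower index cancel, which is [Q1]. *)
Lemma covricE n x l j : O x -> covric n x l j = \sum_k covcurv g n k j x k l.
Proof.
move=> Ox.
have P : pderivmx n Ric x l j = \sum_k pderivmx n (Rm k j) x k l.
  rewrite pderivmxE; under eq_bigr do rewrite pderivmxE.
  rewrite -(pderiv_sum (O := O) (F := fun k y => Rm k j y k l) n _ Ox).
    by congr (pderiv n _ x); apply/funext => y; rewrite ricmx_curvmx.
  by move=> k; exact: (smooth_curvmx Oo sg gT gU).
have Q1 : \sum_k (Gam n x *m Rm k j x) k l =
    \sum_k (\sum_m G m n k x *: Rm m j x) k l.
  rewrite [RHS](eq_bigr (fun k => \sum_m Gam n x m k * Rm m j x k l)).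
    by rewrite exchange_big; apply: eq_bigr => k _; rewrite mxE.
  by move=> k _; rewrite summxE; apply: eq_bigr => m _; rewrite mxE connmxE.
have Q2 : \sum_k (Rm k j x *m Gam n x) k l = ((Gam n x)^T *m Ric x) l j.
  rewrite mxE; under eq_bigr do rewrite mxE.
  rewrite exchange_big; apply: eq_bigr => m _ /=.
  by rewrite mxE ricmx_curvmx mulr_sumr; apply: eq_bigr => k _; rewrite mulrC.
have Q3 : \sum_k (\sum_m G m n j x *: Rm k m x) k l = (Ric x *m Gam n x) l j.
  rewrite mxE; under eq_bigr do rewrite summxE.
  rewrite exchange_big; apply: eq_bigr => m _ /=.
  rewrite ricmx_curvmx mulr_suml; apply: eq_bigr => k _.
  by rewrite mxE connmxE mulrC.
rewrite /covric !(addmxE, oppmxE) P -Q2 -Q3.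
under [RHS]eq_bigr do rewrite /covcurv !(addmxE, oppmxE).
have K (a b c d : R) : a + b - c - b - d = a - c - d by ring.
by rewrite !big_split /= !sumrN Q1 K.
Qed.

Local Notation h x := (invmx (g x)).

(** The inverse metric is parallel, so raising an index commutes with nabla_n. *)
Lemma pderivmx_ricci_mixed n x : O x ->
  pderivmx n (fun y => h y *m Ric y) x
    + Gam n x *m (h x *m Ric x) - (h x *m Ric x) *m Gam n x = h x *m covric n x.
Proof.
move=> Ox; rewrite (pderivmxM Oo n (smooth_invg Oo sg gU) smooth_ricmx Ox).
rewrite (pderivmx_invg Oo sg gT gU n Ox) /covric.
move: (pderivmx _ _ _) (h x) (Ric x) (Gam n x) => p a r c.
rewrite !(mulmxDl, mulmxDr, mulmxBl, mulmxBr, mulNmx, mulmxN, mulmxA).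
by apply/matrixP => e f; rewrite !(addmxE, oppmxE); ring.
Qed.

Lemma scalar_curvatureE x : O x -> s x = \tr (h x *m Ric x).
Proof.
move=> Ox; rewrite /scalar_curvature /trace02 exchange_big.
apply: eq_bigr => j _.
by rewrite mxE; apply: eq_bigr => i _; rewrite ricmxE -{1}invmxT// mxE.
Qed.

(** Trace of [pderivmx_ricci_mixed], where the commutator with Gamma_n has trace 0. *)
Lemma pderiv_scalar_curvature n x : O x ->
  pderiv n s x = \tr (h x *m covric n x).
Proof.
move=> Ox; have sHR := smooth_mxM Oo (smooth_invg Oo sg gU) smooth_ricmx.
rewrite (pderiv_on Oo n Ox scalar_curvatureE).
rewrite (pderiv_sum n (F := fun k y => (h y *m Ric y) k k)
  (fun k => sHR k k) Ox).
rewrite -pderivmx_ricci_mixed// raddfB raddfD /=.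
rewrite [X in _ + X - _]mxtrace_mulC addrK.
by apply: eq_bigr => k _; rewrite pderivmxE.
Qed.

(** In the second Bianchi identity for [k], [i], [j], contraction over [k] turns the terms
    differentiated along [i] and [j] into derivatives of Ricci. *)
Lemma div_curvature l i j x : O x ->
  \sum_k covcurv g k i j x k l = covric i x l j - covric j x l i.
Proof.
move=> Ox; rewrite !covricE// -sumrB; apply: eq_bigr => k _.
have /eqP := second_bianchi Oo sg gT gU k i j Ox.
rewrite -addrA addr_eq0 => /eqP ->; rewrite (covcurvN Oo sg gT gU i k j Ox).
move: (covcurv g i k j x) (covcurv g j k i x) => a b.
by rewrite oppmxE addmxE oppmxE opprD opprK.
Qed.

(* The contracted second Bianchi identity. Contracting [div_curvature] with the
   inverse metric gives [d s - div Ric] on the right; the left-hand side is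
   [div Ric], because the curvature is skew in its first two indices as well. *)
Lemma div_ricci i x : O x ->
  2 * \sum_k (h x *m covric k x) k i = pderiv i s x.
Proof.
move=> Ox; rewrite pderiv_scalar_curvature//.
have hS a b : h x a b = h x b a by rewrite -{1}invmxT// mxE.
have E1 : \sum_k \sum_j (covcurv g k i j x *m h x) k j =
    \tr (h x *m covric i x) - \sum_k (h x *m covric k x) k i.
  rewrite exchange_big -sumrB; apply: eq_bigr => j _.
  under eq_bigr do rewrite mxE; rewrite exchange_big !mxE -sumrB.
  apply: eq_bigr => l _; rewrite -mulr_suml div_curvature// mulrC hS.
  by rewrite mulrBr.
have E2 : \sum_k \sum_j (covcurv g k i j x *m h x) k j =
    \sum_k (h x *m covric k x) k i.
  apply: eq_bigr => k _; rewrite mxE.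
  (* Two signs cancel: one from exchanging [i] and [j], one from transposing the matrix with raised
     index. The index [j] is then contracted as in Ricci. *)
  transitivity (\sum_j (covcurv g k j i x *m h x) j k).
    apply: eq_bigr => j _; rewrite (covcurvN Oo sg gT gU k j i Ox) mulNmx.
    by rewrite -(skew_mul_invmx Ox (covcurv_skew Oo sg gT gU k j i Ox)) mxE.
  under eq_bigr do rewrite mxE; rewrite exchange_big; apply: eq_bigr => l _.
  by rewrite -mulr_suml covricE// mulrC hS.
by rewrite mulr_natl mulr2n -{1}E2 E1 subrK.
Qed.

End RicciCurvature.

(** * The divergence of the Weyl tensor *)

Section WeylDivergence.
Variables (R : realType) (O : set 'rV[R]_4) (g : 'rV[R]_4 -> 'M[R]_4).
Hypotheses (Oo : open O) (sg : smooth_mx O g).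
Hypotheses (gT : forall x, O x -> (g x)^T = g x).
Hypotheses (gU : forall x, O x -> g x \in unitmx).
Implicit Types (x : 'rV[R]_4) (i j k l n : 'I_4).
Implicit Types (A B : 'rV[R]_4 -> 'M[R]_4).
Implicit Types (S T : 'I_4 -> 'I_4 -> 'I_4 -> 'I_4 -> 'rV[R]_4 -> R).

Local Notation G := (christoffel g).
Local Notation Gam := (connmx g).
Local Notation Rm := (curvmx g).
Local Notation Ric := (ricmx g).
Local Notation s := (scalar_curvature g).
Local Notation h x := (invmx (g x)).

(** The product A_{lj} B^k_i. The terms removed from the curvature are combinations of such products
    and of their exchanges of [i] and [j], so the Leibniz rule suffices to differentiate them. *)
Definition tensor A B k l i j : 'rV[R]_4 -> R := fun x => A x l j * B x k i.

Lemma nabla13D S T n k l i j x :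
  (forall k l i j, smooth_on O (S k l i j)) ->
  (forall k l i j, smooth_on O (T k l i j)) -> O x ->
  nabla13 G (fun k l i j y => S k l i j y + T k l i j y) n k l i j x =
    nabla13 G S n k l i j x + nabla13 G T n k l i j x.
Proof.
move=> sS sT Ox; rewrite /nabla13.
have [sSk sTk] := (smooth_on_C0d (sS k l i j), smooth_on_C0d (sT k l i j)).
rewrite (pderivD n sSk sTk Ox).
have D (F U V : 'I_4 -> R) :
    \sum_m F m * (U m + V m) = \sum_m F m * U m + \sum_m F m * V m.
  by rewrite -big_split; apply: eq_bigr => m _; rewrite mulrDr.
rewrite !D.
move: (pderiv n _ x) (pderiv n _ x) => p q.
move: (\sum_m _) (\sum_m _) (\sum_m _) (\sum_m _) => a b c d.
move: (\sum_m _) (\sum_m _) (\sum_m _) (\sum_m _) => a' b' c' d'.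
by ring.
Qed.

Lemma nabla13Z (c : R) S n k l i j x :
  (forall k l i j, smooth_on O (S k l i j)) -> O x ->
  nabla13 G (fun k l i j y => c * S k l i j y) n k l i j x =
    c * nabla13 G S n k l i j x.
Proof.
move=> sS Ox; rewrite /nabla13.
have sc := smooth_on_cst Oo c.
rewrite (pderivM n (smooth_on_C0d sc) (smooth_on_C0d (sS k l i j)) Ox).
rewrite pderiv_cst mul0r addr0.
have D (F U : 'I_4 -> R) : \sum_m F m * (c * U m) = c * \sum_m F m * U m.
  by rewrite mulr_sumr; apply: eq_bigr => m _; rewrite mulrCA.
by rewrite !D -mulrDr -!mulrBr.
Qed.

Lemma nabla13_swap S n k l i j x :
  nabla13 G (fun k l i j y => S k l j i y) n k l i j x =
    nabla13 G S n k l j i x.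
Proof. by rewrite /nabla13 [LHS]addrAC. Qed.

Lemma nabla13_tensor A B n k l i j x : smooth_mx O A -> smooth_mx O B -> O x ->
  nabla13 G (tensor A B) n k l i j x =
    nabla02 G (fun i j y => A y i j) n l j x * B x k i
    + A x l j * nabla11 G (fun k i y => B y k i) n k i x.
Proof.
move=> sA sB Ox; rewrite /nabla13 /tensor /nabla02 /nabla11.
rewrite (pderivM n (smooth_on_C0d (sA l j)) (smooth_on_C0d (sB k i)) Ox).
have L (F U : 'I_4 -> R) c : \sum_m F m * (U m * c) = (\sum_m F m * U m) * c.
  by rewrite mulr_suml; apply: eq_bigr => m _; rewrite mulrA.
have D (F U : 'I_4 -> R) c : \sum_m F m * (c * U m) = c * \sum_m F m * U m.
  by rewrite mulr_sumr; apply: eq_bigr => m _; rewrite mulrCA.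
rewrite !L !D.
move: (pderiv n _ x) (pderiv n _ x) (A x l j) (B x k i) => p q u v.
move: (\sum_m _) (\sum_m _) (\sum_m _) (\sum_m _) => a b c d.
by ring.
Qed.

Lemma pderivmxZ n (f : 'rV[R]_4 -> R) A x : smooth_on O f -> smooth_mx O A ->
  O x -> pderivmx n (fun y => f y *: A y) x =
    pderiv n f x *: A x + f x *: pderivmx n A x.
Proof.
move=> sf sA Ox; apply/matrixP => k l; rewrite addmxE !pderivmxE.
have -> : (fun y => (f y *: A y) k l) = (fun y => f y * A y k l).
  by apply/funext => y; rewrite mxE.
rewrite (pderivM n (smooth_on_C0d sf) (smooth_on_C0d (sA k l)) Ox).
by rewrite addrC mxE [X in _ = _ + X]mxE pderivmxE.
Qed.

Lemma smooth_mxZ (f : 'rV[R]_4 -> R) A : smooth_on O f -> smooth_mx O A ->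
  smooth_mx O (fun x => f x *: A x).
Proof.
move=> sf sA k l; apply: (eq_smooth_on Oo) (smooth_onM Oo sf (sA k l)) => x _.
by rewrite mxE.
Qed.

(** The value [c = - 3^-1] absorbs the scalar term of the Weyl tensor; [c = - 6^-1] gives the tensor
    S. *)
Definition ricci_shift (c : R) x : 'M[R]_4 := Ric x + (c * s x) *: g x.

Lemma smooth_cscalar (c : R) : smooth_on O (fun x => c * s x).
Proof.
apply: (smooth_onM Oo); first exact: (smooth_on_cst Oo).
exact: (smooth_scalar_curvature Oo sg gT gU).
Qed.

Lemma smooth_ricci_shift (c : R) : smooth_mx O (ricci_shift c).
Proof.
apply: (smooth_mxD Oo); first exact: (smooth_ricmx Oo sg gT gU).
by apply: smooth_mxZ sg; exact: smooth_cscalar.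
Qed.

Lemma nabla02_ricci_shift (c : R) n i j x : O x ->
  nabla02 G (fun i j y => ricci_shift c y i j) n i j x =
    covric g n x i j + c * pderiv n s x * g x i j.
Proof.
move=> Ox; have ss := smooth_cscalar c.
have sS := smooth_scalar_curvature Oo sg gT gU.
rewrite nabla02E (pderivmxD n (smooth_ricmx Oo sg gT gU) (smooth_mxZ ss sg) Ox).
rewrite (pderivmxZ n ss sg Ox) (pderivmx_metric Oo gT gU n Ox).
rewrite (pderivM n (smooth_on_C0d (smooth_on_cst Oo c)) (smooth_on_C0d sS) Ox).
rewrite pderiv_cst mul0r addr0 /covric /ricci_shift.
move: (c * pderiv n s x) (c * s x) => p q.
move: (pderivmx n _ x) (Ric x) (Gam n x) (g x) => a r u v.
rewrite !(mulmxDr, mulmxDl) -!scalemxAl -!scalemxAr scalerDr.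
rewrite !(addmxE, oppmxE, scalemxE).
move: ((_ *m r) _ _) ((r *m _) _ _) ((_ *m v) _ _) ((v *m _) _ _).
by move=> b d e f; ring.
Qed.

Lemma nabla02_metric n i j x : O x ->
  nabla02 G (fun i j y => g y i j) n i j x = 0.
Proof.
move=> Ox; rewrite nabla02E (pderivmx_metric Oo gT gU n Ox).
by rewrite addrAC addrK subrr mxE.
Qed.

Lemma nabla11_id n k i x :
  nabla11 G (fun k i _ => (1%:M : 'M[R]_4) k i) n k i x = 0.
Proof.
rewrite (nabla11E g n (fun=> 1%:M)) pderivmx_cst mulmx1 mul1mx.
by rewrite add0r subrr mxE.
Qed.

(* In the Weyl tensor, the part of the curvature to be removed is half the
   alternation in i and j of this tensor. *)
Definition weyl_correction k l i j : 'rV[R]_4 -> R := fun x =>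
  tensor (ricci_shift (- 3^-1)) (fun=> 1%:M) k l i j x
  + tensor g (fun y => h y *m Ric y) k l i j x.

Lemma smooth_tensor A B k l i j : smooth_mx O A -> smooth_mx O B ->
  smooth_on O (tensor A B k l i j).
Proof. by move=> sA sB; exact: (smooth_onM Oo (sA l j) (sB k i)). Qed.

Lemma smooth_id : smooth_mx O (fun=> 1%:M).
Proof. by move=> k l; exact: (smooth_on_cst Oo). Qed.

Let sHR : smooth_mx O (fun y => h y *m Ric y) :=
  smooth_mxM Oo (smooth_invg Oo sg gU) (smooth_ricmx Oo sg gT gU).

Lemma smooth_weyl_correction k l i j : smooth_on O (weyl_correction k l i j).
Proof.
exact: (smooth_onD Oo (smooth_tensor k l i j (smooth_ricci_shift _) smooth_id)
  (smooth_tensor k l i j sg sHR)).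
Qed.

(** The identity factor selects [k = i] in the first product, and the second gives div Ric, that is
    half of ds. The coefficient is 1/2 - 1/3 = 1/6. *)
Lemma div_weyl_correction l i j x : O x ->
  \sum_k nabla13 G weyl_correction k k l i j x =
    covric g i x l j + 6^-1 * pderiv i s x * g x l j.
Proof.
move=> Ox.
have E k : nabla13 G weyl_correction k k l i j x =
    (covric g k x l j + - 3^-1 * pderiv k s x * g x l j) * (k == i)%:R
    + g x l j * (h x *m covric g k x) k i.
  rewrite (nabla13D k k l i j
    (fun k l i j => smooth_tensor k l i j (smooth_ricci_shift _) smooth_id)
    (fun k l i j => smooth_tensor k l i j sg sHR) Ox).
  rewrite (nabla13_tensor k k l i j (smooth_ricci_shift _) smooth_id Ox).
  rewrite (nabla13_tensor k k l i j sg sHR Ox) nabla11_id mulr0 addr0.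
  rewrite nabla02_metric// mul0r add0r nabla02_ricci_shift// [1%:M k i]mxE.
  by rewrite nabla11E (pderivmx_ricci_mixed Oo sg gT gU k Ox).
have D (F : 'I_4 -> R) : \sum_k F k * (k == i)%:R = F i.
  rewrite (bigD1 i)//= eqxx mulr1 big1 ?addr0// => k /negPf ->.
  by rewrite mulr0.
rewrite (eq_bigr _ (fun k _ => E k)) big_split /= D.
rewrite -[X in _ + X](mulr_sumr _ _ _ (g x l j)).
rewrite -(div_ricci Oo sg gT gU i Ox).
by move: (covric g i x l j) (g x l j) (\sum_k _) => a b c; field.
Qed.

Lemma weylE : weyl g = fun k l i j y => curvature g k l i j y
  + (- 2^-1 * weyl_correction k l i j y + 2^-1 * weyl_correction k l j i y).
Proof.
apply/funext => k; apply/funext => l; apply/funext => i; apply/funext => j.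
apply/funext => y; rewrite /weyl /weyl_correction /tensor /ricci_shift.
have M a b : ricci_mixed g a b y = (h y *m Ric y) a b.
  by rewrite mxE; apply: eq_bigr => m _; rewrite ricmxE.
rewrite !M -!ricmxE !addmxE !scalemxE [1%:M k i]mxE [1%:M k j]mxE.
move: (curvature _ _ _ _ _ _) (s y) ((_ *m _) k i) ((_ *m _) k j) => c t p q.
move: (Ric y l i) (Ric y l j) (g y l i) (g y l j) => a b u v.
by move: (k == i)%:R (k == j)%:R => d e; field.
Qed.

(** These are the components of nabla_n S_{ij}; only [s] is differentiated in the second term, since
    nabla g = 0. *)
Definition cov_shifted_ricci n i j x : R :=
  covric g n x i j + - 6^-1 * pderiv n s x * g x i j.

(** The curvature contributes the alternation of nabla Ric. The correction removes half of it,
    together with half of the alternation of ds g / 6, which leaves half the alternation of nabla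
    S. *)
Lemma codiff_weylE l i j x : O x -> codiff_weyl g l i j x =
  - (2^-1 * (cov_shifted_ricci i l j x - cov_shifted_ricci j l i x)).
Proof.
move=> Ox; have sS := smooth_weyl_correction; rewrite /codiff_weyl weylE.
have sSc r a b c d := smooth_onM Oo (smooth_on_cst Oo r) (sS a b c d).
have sC a b c d : smooth_on O (curvature g a b c d).
  apply: (eq_smooth_on Oo) (smooth_curvmx Oo sg gT gU c d a b) => y _.
  by rewrite curvmx_curvature.
have E k : nabla13 G (fun k l i j y => curvature g k l i j y
      + (- 2^-1 * weyl_correction k l i j y + 2^-1 * weyl_correction k l j i y))
      k k l i j x =
    covcurv g k i j x k l + (- 2^-1 * nabla13 G weyl_correction k k l i j x
      + 2^-1 * nabla13 G weyl_correction k k l j i x).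
  rewrite (nabla13D k k l i j sC
    (fun k l i j => smooth_onD Oo (sSc _ k l i j) (sSc _ k l j i)) Ox).
  rewrite (nabla13D k k l i j (sSc _) (fun k l i j => sSc _ k l j i) Ox).
  rewrite nabla13_curvature (nabla13Z _ k k l i j sS Ox).
  rewrite (nabla13Z (S := fun k l i j => weyl_correction k l j i) _ k k l i j
    (fun k l i j => sS k l j i) Ox).
  by rewrite (nabla13_swap weyl_correction).
under eq_bigr do rewrite E.
rewrite !big_split /= -!mulr_sumr !div_weyl_correction//.
rewrite (div_curvature Oo sg gT gU l i j Ox) /cov_shifted_ricci.
move: (covric g i x l j) (covric g j x l i) (g x l j) (g x l i) => a b c d.
by move: (pderiv i s x) (pderiv j s x) => p q; field.
Qed.

Lemma nabla02_on (a b : 'I_4 -> 'I_4 -> 'rV[R]_4 -> R) n i j x : O x ->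
  (forall i j y, O y -> a i j y = b i j y) ->
  nabla02 G a n i j x = nabla02 G b n i j x.
Proof.
move=> Ox ab; rewrite /nabla02 (pderiv_on Oo n Ox (ab i j)).
congr (_ - _ - _).
  by apply: eq_bigr => m _; rewrite (ab m j x Ox).
by apply: eq_bigr => m _; rewrite (ab i m x Ox).
Qed.

Lemma nabla02_shifted_energy n i j x : O x ->
  nabla02 G (fun i j y => energy_momentum g i j y
    - 3^-1 * trace02 g (energy_momentum g) y * g y i j) n i j x =
  cov_shifted_ricci n i j x.
Proof.
move=> Ox; rewrite -[RHS]nabla02_ricci_shift//.
apply: nabla02_on => // {}i {}j y Oy.
(* The trace of [g] is the dimension 4, so trace T = s - 2 s; the coefficient of s g becomes 1/3 -
   1/2 = - 1/6. *)
have -> : trace02 g (energy_momentum g) y = - s y.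
  rewrite /trace02 /energy_momentum.
  under eq_bigr => a _ do under eq_bigr => b _ do rewrite mulrBr mulrCA.
  under eq_bigr => a _ do rewrite sumrB -mulr_sumr.
  rewrite sumrB -mulr_sumr -/(trace02 g (ricci g) y) -/(s y).
  have -> : \sum_a \sum_b h y a b * g y a b = \tr (h y *m g y).
    apply: eq_bigr => a _; rewrite mxE; apply: eq_bigr => b _.
    by rewrite -{2}(gT Oy) mxE.
  by rewrite mulVmx ?gU// mxtrace1; field.
rewrite /energy_momentum /ricci_shift addmxE scalemxE ricmxE.
by move: (s y) (g y i j) (ricci g i j y) => a b c; field.
Qed.

(** Symmetry of Ric and [g] is inherited by their covariant derivatives. It reconciles the index
    positions in dS = 0 with those in the codifferential. *)
Lemma cov_shifted_ricciC n i j x : O x ->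
  cov_shifted_ricci n i j x = cov_shifted_ricci n j i x.
Proof.
move=> Ox; have gS : g x i j = g x j i by rewrite -{1}(gT Ox) mxE.
have RT : (Ric x)^T = Ric x by exact: (ricmxT Oo sg gT gU Ox).
have DT : (pderivmx n Ric x)^T = pderivmx n Ric x.
  by rewrite -pderivmx_tr; exact: (pderivmx_on Oo n Ox (ricmxT Oo sg gT gU)).
have CT : (covric g n x)^T = covric g n x.
  rewrite /covric !raddfB /= !trmx_mul trmxK RT DT.
  exact: addrAC.
by rewrite /cov_shifted_ricci gS -{1}CT mxE.
Qed.

Lemma codiff_weyl0P : closed02 g O (fun i j x => energy_momentum g i j x
    - 3^-1 * trace02 g (energy_momentum g) x * g x i j) <->
  (forall x, O x -> forall l i j, codiff_weyl g l i j x = 0).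
Proof.
split=> [cl x Ox l i j|W x Ox k i j].
  rewrite codiff_weylE// (cov_shifted_ricciC i l j)//.
  rewrite (cov_shifted_ricciC j l i)//.
  have := cl x Ox i j l; rewrite !nabla02_shifted_energy// => ->.
  by rewrite subrr mulr0 oppr0.
rewrite !nabla02_shifted_energy// (cov_shifted_ricciC k i j)//.
rewrite (cov_shifted_ricciC i k j)//.
(* The index [j], which is not alternated in dS = 0, takes the place of [l] in the
   codifferential. *)
have /eqP := W x Ox j k i; rewrite codiff_weylE// oppr_eq0 mulf_eq0.
by rewrite invr_eq0 pnatr_eq0 subr_eq0 => /eqP.
Qed.

End WeylDivergence.

(** * From charts to the space-time *)

Lemma lorentz_signature_unitmx (R : realType) (A : 'M[R]_4) :
  lorentz_signature A -> A \in unitmx.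
Proof.
move=> [P _ E]; have : P *m A *m P^T \in unitmx.
  rewrite E unitmxE unitfE det_diag; apply/prodf_neq0 => i _.
  by rewrite mxE; case: ifP => _; rewrite ?oppr_eq0 oner_eq0.
by rewrite !unitmx_mul => /andP[/andP[_ ->]].
Qed.

Theorem theorem6 (R : realType) (M : manifold4 R) (g : lorentz_metric M) :
  einstein_class_Omega23 g <-> weyl_harmonic g.
Proof.
(* Both conditions are imposed chart by chart on the components of the metric, so the local
   equivalence is applied in each chart. *)
have P u := codiff_weyl0P (@chart_cod_open _ _ (atlas u))
  (@metric_smooth _ _ g u)
  (@Defs.metric_sym _ _ g u)
  (fun x Ox => lorentz_signature_unitmx (@metric_signature _ _ g u x Ox)).
by split=> H u; apply/P; exact: H.
Qed.
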